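(* Given $\beta\in B_n$, for any $t>0$ and any homomorphism $\gamma:F_n\to G$ through which $\phi$ factors ($G$ a countable discrete group), there exists a map $\Theta:B(\ell^2(G)^n)\to M_{n,n}(\mathbb{Z}[T,T^{-1}])$ such that $\Theta\left(\mathcal{B}^{(2)}_{t,\gamma}(\beta)\right)=\mathcal{B}(\beta)$. In particular, if $\alpha,\beta\in B_n$ and $\mathcal{B}^{(2)}_{t,\gamma}(\alpha)=\mathcal{B}^{(2)}_{t,\gamma}(\beta)$, then $\mathcal{B}(\alpha)=\mathcal{B}(\beta)$.
   Context: **Operators.** For a countable discrete group $G$, $\ell^2(G)$ is the Hilbert space of square-summable functions $G\to\mathbb{C}$; $B(H)$ denotes the bounded operators on a Hilbert space $H$. For $h\in G$, $R_h$ is the operator extending $g\mapsto gh$; $R_w$ for $w\in\mathbb{C}[G]$ is defined by linearity. Elements of $\ell^2(G)^n$ are column vectors and matrices over $B(\ell^2(G))$ act on the left, so $M_{n,n}(B(\ell^2(G)))$ is identified with $B(\ell^2(G)^n)$. **Braids.** $D_n$ is the closed unit disk with $n$ interior punctures $p_1<\dots<p_n$ on the real axis, $z\in\partial D_n$ a basepoint, and $x_i$ the simple loop at $z$ turning once counterclockwise around $p_i$, so that $\pi_1(D_n,z)=F_n$ is free on $x_1,\dots,x_n$. The braid group $B_n$ on $n$ strands, with standard generators $\sigma_1,\dots,\sigma_{n-1}$, is identified with the group of isotopy classes of orientation-preserving homeomorphisms of $D_n$ fixing $\partial D^2$ pointwise. If $H_\beta$ represents $\beta$, $h_\beta$ is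 the induced automorphism of $F_n$; conventions are such that $h_{\alpha\beta}=h_\beta\circ h_\alpha$ and $h_{\sigma_i}(x_i)=x_ix_{i+1}x_i^{-1}$, $h_{\sigma_i}(x_{i+1})=x_i$, $h_{\sigma_i}(x_j)=x_j$ for $j\ne i,i+1$. $\phi:F_n\to\mathbb{Z}$ is the homomorphism $x_i\mapsto1$; $\phi\circ h_\beta=\phi$. **$L^2$-Burau map.** Let $\kappa:\mathbb{Z}[F_n]\to\mathbb{R}[G]$ be the ring homomorphism $g\mapsto t^{\phi(g)}\gamma(g)$; $\ell^2(G)$ is a right $\mathbb{Z}[F_n]$-module via $a\cdot g=R_{\kappa(g)}(a)$. With $p:\widetilde D_n\to D_n$ the universal cover and $\widetilde z=p^{-1}(z)$, $C_1(\widetilde D_n,\widetilde z)$ ($\cong H_1(\widetilde D_n,\widetilde z;\mathbb{Z})$) is the free left $\mathbb{Z}[F_n]$-module on the lifts $\widetilde x_i$ of the $x_i$ starting at a fixed lift of $z$, and $H_1^{(2)}(D_n,z;\phi,\gamma,t)=\ell^2(G)\otimes_{\mathbb{Z}[F_n]}C_1(\widetilde D_n,\widetilde z)=\bigoplus_{i=1}^n\ell^2(G)\,\widetilde x_i$. The lift $\widetilde H_\beta$ of $H_\beta$ fixing the chosen lift of $z$ induces an isomorphism $\mathrm{id}\otimes\widetilde H_\beta: H_1^{(2)}(D_n,z;\phi,\gamma\circ h_\beta,t)\to H_1^{(2)}(D_n,z;\phi,\gamma,t)$; its matrix in the bases $(\widetilde x_i)$ is the $L^2$-Burau map $\mathcal{B}^{(2)}_{t,\gamma}(\beta)\in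 M_{n,n}(B(\ell^2(G)))$. **Classical Burau representation.** The Fox derivative $\partial/\partial x_j:\mathbb{Z}[F_n]\to\mathbb{Z}[F_n]$ is the linear map with $\partial x_i/\partial x_j=\delta_{ij}$ and $\partial(uv)/\partial x_j=\partial u/\partial x_j+u\,\partial v/\partial x_j$ for $u,v\in F_n$. $\mathcal{B}(\beta)\in M_{n,n}(\mathbb{Z}[T,T^{-1}])$ is the matrix with $(i,j)$-entry $T^\phi\left(\partial h_\beta(x_i)/\partial x_j\right)$, where $T^\phi:\mathbb{Z}[F_n]\to\mathbb{Z}[T,T^{-1}]$ is the ring homomorphism sending each $x_i$ to the indeterminate $T$. *)

(* Defs.v *)
From HB Require Import structures.
From mathcomp Require Import all_boot all_order all_algebra.
From mathcomp Require Import finmap.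
From mathcomp Require Import boolp classical_sets functions cardinality reals ereal esum.
From mathcomp Require Import fsbigop complex ring.

Set Implicit Arguments.
Unset Strict Implicit.
Unset Printing Implicit Defensive.

Import Order.TTheory GRing.Theory Num.Theory.
Local Open Scope ring_scope.

(* [(x, true)] stands for the generator [x], [(x, false)] for its inverse. *)
Definition word (X : Type) : Type := seq (X * bool).

Definition word_inv X (w : word X) : word X :=
  rev [seq (l.1, ~~ l.2) | l <- w].

Section Presentation.
Variables (X : choiceType) (E : word X -> word X -> Prop).

Inductive pres_eq : word X -> word X -> Prop :=
| pres_refl w : pres_eq w w
| pres_sym v w : pres_eq v w -> pres_eq w v
| pres_trans u v w : pres_eq u v -> pres_eq v w -> pres_eq u w
| pres_cancel u v x b : pres_eq (u ++ (x, b) :: (x, ~~ b) :: v) (u ++ v)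
| pres_rel u v r s : E r s -> pres_eq (u ++ r ++ v) (u ++ s ++ v).

Definition pres_eqb (v w : word X) : bool := `[< pres_eq v w >].

Lemma pres_eqb_refl : reflexive pres_eqb.
Proof. by move=> w; apply/asboolP; apply: pres_refl. Qed.

Lemma pres_eqb_sym : symmetric pres_eqb.
Proof. by move=> v w; apply/asboolP/asboolP; apply: pres_sym. Qed.

Lemma pres_eqb_trans : transitive pres_eqb.
Proof.
by move=> v u w /asboolP uv /asboolP vw; apply/asboolP; apply: pres_trans vw.
Qed.

Canonical pres_equiv :=
  EquivRel pres_eqb pres_eqb_refl pres_eqb_sym pres_eqb_trans.

Definition pres : Type := {eq_quot pres_eqb}%qT.
HB.instance Definition _ := Choice.on pres.
HB.instance Definition _ := EqQuotient.on pres.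

Definition pclass (w : word X) : pres := (\pi w)%qT.

Lemma pclassP v w : pclass v = pclass w <-> pres_eq v w.
Proof.
split=> [/eqP|vw]; first by rewrite piE => /asboolP.
by apply/eqP; rewrite piE; apply/asboolP.
Qed.

Lemma prepr (p : pres) : pclass (repr p) = p.
Proof. exact: reprK. Qed.

Lemma pres_catl u v w : pres_eq v w -> pres_eq (u ++ v) (u ++ w).
Proof.
elim=> {v w} [w|v w _|v1 v w _ IH1 _|a v x b|a v r s rs].
- exact: pres_refl.
- exact: pres_sym.
- exact: pres_trans.
- by rewrite !catA; apply: pres_cancel.
- by rewrite 2!(catA u); apply: pres_rel.
Qed.

Lemma pres_catr u v w : pres_eq v w -> pres_eq (v ++ u) (w ++ u).
Proof.
elim=> {v w} [w|v w _|v1 v w _ IH1 _|a v x b|a v r s rs].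
- exact: pres_refl.
- exact: pres_sym.
- exact: pres_trans.
- by rewrite -!catA /=; apply: pres_cancel.
- by rewrite -!catA; apply: pres_rel.
Qed.

Lemma pres_cat v v' w w' :
  pres_eq v v' -> pres_eq w w' -> pres_eq (v ++ w) (v' ++ w').
Proof.
by move=> vv' ww'; apply: pres_trans (pres_catr w vv') (pres_catl v' ww').
Qed.

Lemma pres_invl w : pres_eq (word_inv w ++ w) [::].
Proof.
elim: w => [|[x b] w IH]; first exact: pres_refl.
rewrite /word_inv /= rev_cons -cats1 -catA /=; apply: pres_trans IH.
by have := pres_cancel (word_inv w) w x (~~ b); rewrite negbK.
Qed.

Lemma word_invK : involutive (@word_inv X).
Proof.
move=> w; rewrite /word_inv map_rev revK -map_comp -[RHS]map_id.
by apply: eq_map => -[x b] /=; rewrite negbK.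
Qed.

Lemma pres_invr w : pres_eq (w ++ word_inv w) [::].
Proof. by rewrite -{1}(word_invK w); apply: pres_invl. Qed.

Definition pres_one : pres := pclass [::].
Definition pres_mul (p q : pres) : pres := pclass (repr p ++ repr q).
Definition pres_inv (p : pres) : pres := pclass (word_inv (repr p)).

Lemma pres_reprK w : pres_eq (repr (pclass w)) w.
Proof. by apply/pclassP; rewrite prepr. Qed.

Lemma pclass_cat v w : pclass (v ++ w) = pres_mul (pclass v) (pclass w).
Proof. by apply/pclassP/pres_sym/pres_cat; apply: pres_reprK. Qed.

Lemma pres_mulA : associative pres_mul.
Proof.
move=> p q r; rewrite -(prepr p) -(prepr q) -(prepr r).
by rewrite -!pclass_cat catA.
Qed.

Lemma pres_mul1 : left_id pres_one pres_mul.
Proof. by move=> p; rewrite -(prepr p) -pclass_cat. Qed.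

Lemma pres_mulr1 : right_id pres_one pres_mul.
Proof. by move=> p; rewrite -(prepr p) -pclass_cat cats0. Qed.

Lemma pres_mulV : left_inverse pres_one pres_inv pres_mul.
Proof.
move=> p; rewrite -{2}(prepr p) -pclass_cat.
by apply/pclassP; apply: pres_invl.
Qed.

Lemma pres_mulrV : right_inverse pres_one pres_inv pres_mul.
Proof.
move=> p; rewrite -{1}(prepr p) -pclass_cat.
by apply/pclassP; apply: pres_invr.
Qed.

HB.instance Definition _ := isGroup.Build pres
  pres_mulA pres_mul1 pres_mulr1 pres_mulV pres_mulrV.

Definition pgen (x : X) : pres := pclass [:: (x, true)].

Lemma pclass_nil : pclass [::] = 1%g.
Proof. by []. Qed.

Lemma pclassM v w : pclass (v ++ w) = (pclass v * pclass w)%g.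
Proof. exact: pclass_cat. Qed.

End Presentation.

Section Evaluation.
Variables (X : choiceType) (E : word X -> word X -> Prop) (K : groupType).
Variable f : X -> K.

Definition letter_eval (l : X * bool) : K :=
  if l.2 then f l.1 else (f l.1)^-1%g.

Definition word_eval (w : word X) : K :=
  foldr (fun l k => (letter_eval l * k)%g) 1%g w.

(* The homomorphism pres E -> K extending f; it is one as soon as f
   satisfies the relations, see pres_lift_morph below. *)
Definition pres_lift (p : pres E) : K := word_eval (repr p).

Lemma word_eval_cat v w : word_eval (v ++ w) = (word_eval v * word_eval w)%g.
Proof.
by elim: v => [|l v IH] /=; [rewrite mul1g | rewrite IH mulgA].
Qed.

Hypothesis fE : forall r s, E r s -> word_eval r = word_eval s.

Lemma word_eval_eq v w : pres_eq E v w -> word_eval v = word_eval w.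
Proof.
elim=> {v w} // [u v w _ -> _ -> //|u v x b|u v r s /fE rs].
  rewrite !word_eval_cat /=; congr (_ * _)%g.
  by case: b; rewrite /letter_eval /= ?mulKg ?mulVKg.
by rewrite !word_eval_cat rs.
Qed.

Lemma pres_lift_class w : pres_lift (pclass E w) = word_eval w.
Proof. by apply: word_eval_eq; apply: pres_reprK. Qed.

Lemma pres_lift_gen x : pres_lift (pgen E x) = f x.
Proof. by rewrite pres_lift_class /= mulg1. Qed.

Lemma pres_lift_morph : monoid.monoid_morphism pres_lift.
Proof.
split=> [|p q]; first by rewrite -pclass_nil pres_lift_class.
by rewrite -(prepr p) -(prepr q) -pclassM !pres_lift_class word_eval_cat.
Qed.

End Evaluation.

Lemma mulg_morph1 (K L : groupType) (f : K -> L) :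
  {morph f : x y / (x * y)%g} -> f 1%g = 1%g.
Proof. by move=> fM; apply: (@mulgI _ (f 1%g)); rewrite -fM !mulg1. Qed.

Lemma mulg_morphV (K L : groupType) (f : K -> L) :
  {morph f : x y / (x * y)%g} -> {morph f : x / x^-1%g}.
Proof.
move=> fM x; apply: (@mulgI _ (f x)).
by rewrite -fM !mulgV mulg_morph1.
Qed.

(* Group automorphisms; the product a * b of the group structure below is
   b \o a, so that h_(alpha beta) = h_beta \o h_alpha for [artin]. *)
Record gaut (K : groupType) := GAut {
  gaut_fun :> K -> K;
  gaut_inv : K -> K;
  gaut_M : {morph gaut_fun : x y / (x * y)%g};
  gaut_K : cancel gaut_fun gaut_inv;
  gaut_VK : cancel gaut_inv gaut_fun }.

HB.instance Definition _ K := gen_eqMixin (gaut K).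
HB.instance Definition _ K := gen_choiceMixin (gaut K).

Section GAut.
Variable K : groupType.
Implicit Types a b : gaut K.

Lemma gaut_eq a b : a =1 b -> a = b.
Proof.
case: a b => [f f' fM fK f'K] [g g' gM gK g'K] /= fg.
have efg : f = g by apply/funext.
subst g; have efg' : f' = g' by apply/funext => x; rewrite -{1}(g'K x) fK.
by subst g'; congr GAut; exact: Prop_irrelevance.
Qed.

Definition gaut1 : gaut K :=
  @GAut K id id (fun _ _ => erefl) (fun _ => erefl) (fun _ => erefl).

Lemma gaut_comp_M a b : {morph b \o a : x y / (x * y)%g}.
Proof. by move=> x y /=; rewrite !gaut_M. Qed.

Definition gaut_comp a b : gaut K :=
  GAut (gaut_comp_M a b)
    (can_comp (gaut_K b) (gaut_K a)) (can_comp (gaut_VK a) (gaut_VK b)).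

Lemma gaut_inv_M a : {morph gaut_inv a : x y / (x * y)%g}.
Proof.
by move=> x y; rewrite -{1}(gaut_VK a x) -{1}(gaut_VK a y) -gaut_M gaut_K.
Qed.

Definition gaut_opp a : gaut K := GAut (gaut_inv_M a) (gaut_VK a) (gaut_K a).

Lemma gaut_compA : associative gaut_comp.
Proof. by move=> a b c; apply: gaut_eq. Qed.

Lemma gaut_comp1 : left_id gaut1 gaut_comp.
Proof. by move=> a; apply: gaut_eq. Qed.

Lemma gaut_compr1 : right_id gaut1 gaut_comp.
Proof. by move=> a; apply: gaut_eq. Qed.

Lemma gaut_compV : left_inverse gaut1 gaut_opp gaut_comp.
Proof. by move=> a; apply: gaut_eq => x /=; rewrite gaut_VK. Qed.

Lemma gaut_comprV : right_inverse gaut1 gaut_opp gaut_comp.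
Proof. by move=> a; apply: gaut_eq => x /=; rewrite gaut_K. Qed.

HB.instance Definition _ := isGroup.Build (gaut K)
  gaut_compA gaut_comp1 gaut_compr1 gaut_compV gaut_comprV.

Lemma gaut_mulE a b x : (a * b)%g x = b (a x).
Proof. by []. Qed.

Lemma gaut_f1 a : a 1%g = 1%g.
Proof. exact: mulg_morph1 (gaut_M a). Qed.

Lemma gaut_fV a x : a x^-1%g = (a x)^-1%g.
Proof. exact: mulg_morphV (gaut_M a) x. Qed.

End GAut.

Definition no_rel n (r s : word 'I_n) : Prop := False.

Definition freegrp n : Type := pres (@no_rel n).
HB.instance Definition _ n := Group.on (freegrp n).

Definition xgen n (i : 'I_n) : freegrp n := pgen (@no_rel n) i.

Definition free_lift n (K : groupType) (f : 'I_n -> K) (u : freegrp n) : K :=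
  pres_lift f u.

Section FreeLift.
Variables (n : nat) (K : groupType).
Implicit Type f : 'I_n -> K.

Lemma free_lift_gen f i : free_lift f (xgen i) = f i.
Proof. by apply: pres_lift_gen. Qed.

Lemma free_lift_class f w : free_lift f (pclass (@no_rel n) w) = word_eval f w.
Proof. by apply: pres_lift_class. Qed.

Lemma free_lift_morph f : monoid.monoid_morphism (free_lift f).
Proof. by apply: pres_lift_morph. Qed.

HB.instance Definition _ f :=
  isUMagmaMorphism.Build (freegrp n) K (free_lift f) (free_lift_morph f).

Lemma free_lift_eq (g : freegrp n -> K) f :
  {morph g : u v / (u * v)%g} -> (forall i, g (xgen i) = f i) ->
  g =1 free_lift f.
Proof.
move=> gM gf u; rewrite -(prepr u) free_lift_class.
have g1 := mulg_morph1 gM; have gV := mulg_morphV gM.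
elim: (repr u) => [|[i b] w IH]; first by rewrite pclass_nil.
rewrite -cat1s pclassM gM IH /=; congr (_ * _)%g.
rewrite /letter_eval /=; case: b; first exact: gf.
rewrite -gf -gV; congr g; apply: (@mulgI _ (xgen i)).
rewrite mulgV -pclassM -pclass_nil; apply/pclassP.
exact: (@pres_cancel _ _ [::] [::]).
Qed.

Lemma free_ext (g g' : freegrp n -> K) :
  {morph g : u v / (u * v)%g} -> {morph g' : u v / (u * v)%g} ->
  (forall i, g (xgen i) = g' (xgen i)) -> g =1 g'.
Proof.
move=> gM g'M gg' u.
by rewrite (free_lift_eq gM gg') -(free_lift_eq g'M (fun=> erefl)).
Qed.

End FreeLift.

Section Braids.
Variable n : nat.

(* Artin's relations; [sigma_(i + 1)] is the letter [i : 'I_n.-1]. *)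
Inductive braid_rel : word 'I_n.-1 -> word 'I_n.-1 -> Prop :=
| braid_far (i j : 'I_n.-1) : (i.+1 < j)%N ->
    braid_rel [:: (i, true); (j, true)] [:: (j, true); (i, true)]
| braid_near (i j : 'I_n.-1) : j = i.+1 :> nat ->
    braid_rel [:: (i, true); (j, true); (i, true)]
              [:: (j, true); (i, true); (j, true)].

Definition braid : Type := pres braid_rel.
HB.instance Definition _ := Group.on braid.

Definition bsigma (i : 'I_n.-1) : braid := pgen braid_rel i.

Lemma lstrand_subproof (i : 'I_n.-1) : (i < n)%N.
Proof. by apply: leq_trans (ltn_ord i) (leq_pred n). Qed.

Lemma rstrand_subproof (i : 'I_n.-1) : (i.+1 < n)%N.
Proof. by case: n i => [|m] [k lt_km]. Qed.

Definition lstrand (i : 'I_n.-1) : 'I_n := Ordinal (lstrand_subproof i).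
Definition rstrand (i : 'I_n.-1) : 'I_n := Ordinal (rstrand_subproof i).

Definition artin_fun (i : 'I_n.-1) : freegrp n -> freegrp n :=
  free_lift (fun k =>
    if k == lstrand i then
      (xgen (lstrand i) * xgen (rstrand i) * (xgen (lstrand i))^-1)%g
    else if k == rstrand i then xgen (lstrand i)
    else xgen k).

Definition artin_inv (i : 'I_n.-1) : freegrp n -> freegrp n :=
  free_lift (fun k =>
    if k == lstrand i then xgen (rstrand i)
    else if k == rstrand i then
      ((xgen (rstrand i))^-1 * xgen (lstrand i) * xgen (rstrand i))%g
    else xgen k).

Lemma strand_neq i : (rstrand i == lstrand i) = false.
Proof. by rewrite -val_eqE /= gtn_eqF. Qed.

Lemma artin_funK i : cancel (artin_fun i) (artin_inv i).
Proof.
apply: (free_ext (g := artin_inv i \o artin_fun i) (g' := id)) => //.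
  by move=> u v; rewrite /artin_fun /artin_inv /= !gmulfM.
move=> k /=; rewrite /artin_fun free_lift_gen.
have [->|kl] := eqVneq k (lstrand i).
  rewrite /artin_inv !gmulfM gmulfV /= !free_lift_gen eqxx strand_neq eqxx.
  by rewrite !mulgA mulgV mul1g mulgK.
have [->|kr] := eqVneq k (rstrand i).
  by rewrite /artin_inv !free_lift_gen eqxx.
by rewrite /artin_inv free_lift_gen (negPf kl) (negPf kr).
Qed.

Lemma artin_invK i : cancel (artin_inv i) (artin_fun i).
Proof.
apply: (free_ext (g := artin_fun i \o artin_inv i) (g' := id)) => //.
  by move=> u v; rewrite /artin_fun /artin_inv /= !gmulfM.
move=> k /=; rewrite /artin_inv free_lift_gen.
have [->|kl] := eqVneq k (lstrand i).
  by rewrite /artin_fun !free_lift_gen eqxx strand_neq.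
have [->|kr] := eqVneq k (rstrand i).
  rewrite /artin_fun !gmulfM gmulfV /= !free_lift_gen eqxx strand_neq eqxx.
  by rewrite !mulgA mulVg mul1g mulgVK.
by rewrite /artin_fun free_lift_gen (negPf kl) (negPf kr).
Qed.

Lemma artin_funM i : {morph artin_fun i : u v / (u * v)%g}.
Proof. exact: gmulfM. Qed.

Definition artin_gen (i : 'I_n.-1) : gaut (freegrp n) :=
  GAut (artin_funM i) (artin_funK i) (artin_invK i).

Definition artin (beta : braid) : gaut (freegrp n) := pres_lift artin_gen beta.

Lemma artin_gen_l i :
  artin_gen i (xgen (lstrand i)) =
  (xgen (lstrand i) * xgen (rstrand i) * (xgen (lstrand i))^-1)%g.
Proof. by rewrite /= /artin_fun free_lift_gen eqxx. Qed.

Lemma artin_gen_r i : artin_gen i (xgen (rstrand i)) = xgen (lstrand i).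
Proof. by rewrite /= /artin_fun free_lift_gen strand_neq eqxx. Qed.

Lemma artin_gen_other i k : k != lstrand i -> k != rstrand i ->
  artin_gen i (xgen k) = xgen k.
Proof. by move=> kl kr; rewrite /= /artin_fun free_lift_gen !ifN. Qed.

Lemma artin_far (i j : 'I_n.-1) : (i.+1 < j)%N ->
  (artin_gen i * artin_gen j = artin_gen j * artin_gen i)%g.
Proof.
move=> ij; apply/gaut_eq/free_ext; [exact: gaut_M | exact: gaut_M |].
have neq (a b : 'I_n) : (a < b)%N -> (a != b) && (b != a).
  by move=> ab; rewrite [b == a]eq_sym andbb -val_eqE ltn_eqF.
have /andP[ll1 ll2] : (lstrand i != lstrand j) && (lstrand j != lstrand i).
  by apply: neq => /=; apply: ltnW.
have /andP[lr1 lr2] : (lstrand i != rstrand j) && (rstrand j != lstrand i).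
  by apply: neq => /=; apply: ltnW; rewrite ltnS ltnW.
have /andP[rl1 rl2] : (rstrand i != lstrand j) && (lstrand j != rstrand i).
  exact: neq.
have /andP[rr1 rr2] : (rstrand i != rstrand j) && (rstrand j != rstrand i).
  by apply: neq => /=; rewrite ltnS ltnW.
move=> k; rewrite !gaut_mulE.
have [->|kli] := eqVneq k (lstrand i).
  rewrite artin_gen_l (artin_gen_other ll1 lr1) artin_gen_l !gaut_M gaut_fV.
  by rewrite !artin_gen_other.
have [->|kri] := eqVneq k (rstrand i).
  by rewrite artin_gen_r (artin_gen_other rl1 rr1) artin_gen_r artin_gen_other.
rewrite (artin_gen_other kli kri).
have [->|klj] := eqVneq k (lstrand j).
  by rewrite artin_gen_l !gaut_M gaut_fV !artin_gen_other.
have [->|krj] := eqVneq k (rstrand j).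
  by rewrite artin_gen_r artin_gen_other.
by rewrite !artin_gen_other.
Qed.

Lemma artin_near (i j : 'I_n.-1) : j = i.+1 :> nat ->
  (artin_gen i * (artin_gen j * artin_gen i) =
   artin_gen j * (artin_gen i * artin_gen j))%g.
Proof.
move=> ij; apply/gaut_eq/free_ext; [exact: gaut_M | exact: gaut_M |].
have e : rstrand i = lstrand j by apply: val_inj; rewrite /= ij.
have l1 : lstrand i != lstrand j.
  by rewrite -val_eqE /= ij neq_ltn ltnSn.
have l2 : lstrand i != rstrand j.
  by rewrite -val_eqE /= ij neq_ltn ltnS leqnSn.
have r1 : rstrand j != lstrand i by rewrite eq_sym.
have r2 : rstrand j != rstrand i by rewrite e strand_neq.
have glj : artin_gen i (xgen (lstrand j)) = xgen (lstrand i).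
  by rewrite -e artin_gen_r.
move=> k; rewrite !gaut_mulE.
have [->|kl] := eqVneq k (lstrand i).
  rewrite (artin_gen_other l1 l2) !artin_gen_l e !(gaut_M, gaut_fV).
  rewrite !(artin_gen_l, artin_gen_other l1 l2, gaut_M, gaut_fV) glj.
  rewrite !(artin_gen_l, e, gaut_M, gaut_fV).
  rewrite (artin_gen_other r1 r2) ?(artin_gen_other l1 l2).
  by rewrite !invgM invgK !mulgA !mulgVK ?mulgK.
have [->|kr] := eqVneq k (lstrand j).
  rewrite glj (artin_gen_other l1 l2) !artin_gen_l e.
  rewrite !(artin_gen_l, glj, artin_gen_other l1 l2, gaut_M, gaut_fV).
  by rewrite (artin_gen_other r1 r2) artin_gen_r.
have kr' : k != rstrand i by rewrite e.
rewrite (artin_gen_other kl kr').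
have [->|kr2] := eqVneq k (rstrand j).
  by rewrite artin_gen_r glj (artin_gen_other l1 l2).
by rewrite !artin_gen_other.
Qed.

Lemma artin_rel r s : braid_rel r s ->
  word_eval artin_gen r = word_eval artin_gen s.
Proof.
by case=> i j ij; rewrite /= /letter_eval /= !mulg1;
  [apply: artin_far | apply: artin_near].
Qed.

Lemma artin_sigma i : artin (bsigma i) = artin_gen i.
Proof. exact: (pres_lift_gen artin_rel). Qed.

Lemma artinM a b u : artin (a * b)%g u = artin b (artin a u).
Proof. by rewrite /artin (pres_lift_morph artin_rel).2. Qed.

End Braids.

Definition gring (R : nzRingType) (G : groupType) : Type :=
  {fsfun G -> R with 0}.

Section GroupRing.
Variables (R : nzRingType) (G : groupType).
Local Notation RG := (gring R G).
Implicit Types (v w : RG) (g h : G) (r s : R).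

HB.instance Definition _ := Choice.on RG.

Definition gcoef (w : RG) (g : G) : R := w g.

Definition gsupp (w : RG) : {fset G} := finsupp w.

Definition gdelta (r : R) (g : G) : RG := [fsfun x in [fset g]%fset => r].

Definition gzero : RG := [fsfun].
Definition gopp w : RG := [fsfun x in gsupp w => - w x].
Definition gadd v w : RG := [fsfun x in (gsupp v `|` gsupp w)%fset => v x + w x].

Lemma gringP v w : (forall g, gcoef v g = gcoef w g) -> v = w.
Proof. by move=> vw; apply/fsfunP. Qed.

Lemma gsupp_out w g : g \notin gsupp w -> gcoef w g = 0.
Proof. exact: fsfun_dflt. Qed.

Lemma mem_gsupp w g : (g \in gsupp w) = (gcoef w g != 0).
Proof. exact: mem_finsupp. Qed.

Lemma gzeroE g : gcoef gzero g = 0.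
Proof. by rewrite /gcoef fsfun0E. Qed.

Lemma goppE w g : gcoef (gopp w) g = - gcoef w g.
Proof.
rewrite /gcoef fsfunE; case: ifPn => // /gsupp_out.
by rewrite /gcoef => ->; rewrite oppr0.
Qed.

Lemma gaddE v w g : gcoef (gadd v w) g = gcoef v g + gcoef w g.
Proof.
rewrite /gcoef fsfunE; case: ifPn => //; rewrite in_fsetU negb_or.
by case/andP => /gsupp_out + /gsupp_out; rewrite /gcoef => -> ->; rewrite addr0.
Qed.

Lemma gaddA : associative gadd.
Proof. by move=> u v w; apply/gringP => g; rewrite !gaddE addrA. Qed.

Lemma gaddC : commutative gadd.
Proof. by move=> u v; apply/gringP => g; rewrite !gaddE addrC. Qed.

Lemma gadd0 : left_id gzero gadd.
Proof. by move=> u; apply/gringP => g; rewrite gaddE gzeroE add0r. Qed.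

Lemma gaddN : left_inverse gzero gopp gadd.
Proof. by move=> u; apply/gringP => g; rewrite gaddE goppE gzeroE addNr. Qed.

HB.instance Definition _ := GRing.isZmodule.Build RG gaddA gaddC gadd0 gaddN.

Lemma gcoefD v w g : gcoef (v + w) g = gcoef v g + gcoef w g.
Proof. exact: gaddE. Qed.

Lemma gcoef0 g : gcoef 0 g = 0.
Proof. exact: gzeroE. Qed.

Lemma gcoef_sum I (s : seq I) (P : pred I) (F : I -> RG) g :
  gcoef (\sum_(i <- s | P i) F i) g = \sum_(i <- s | P i) gcoef (F i) g.
Proof. by apply: (big_morph (gcoef^~ g)) => [v w|]; [apply: gcoefD | apply: gcoef0]. Qed.

Lemma gdeltaE r g h : gcoef (gdelta r g) h = if h == g then r else 0.
Proof. by rewrite /gcoef fsfunE in_fset1. Qed.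

Lemma gdelta0 g : gdelta 0 g = 0.
Proof. by apply/gringP => h; rewrite gdeltaE gcoef0 if_same. Qed.

Lemma gdeltaD r s g : gdelta (r + s) g = gdelta r g + gdelta s g.
Proof.
by apply/gringP => h; rewrite gcoefD !gdeltaE; case: ifP; rewrite ?addr0.
Qed.

Lemma gringEw (D : {fset G}) w : (gsupp w `<=` D)%fset ->
  w = \sum_(g <- D) gdelta (gcoef w g) g.
Proof.
move=> /fsubsetP wD; apply/gringP => g; rewrite gcoef_sum.
have [gD|gND] := boolP (g \in D).
  rewrite (big_fsetD1 g) //= gdeltaE eqxx big1_fset ?addr0 // => h.
  by rewrite in_fsetD1 gdeltaE eq_sym => /andP[/negPf ->].
rewrite big1_fset ?gsupp_out //; first by apply: contra gND; apply: wD.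
by move=> h hD _; rewrite gdeltaE; case: eqP gND => // ->; rewrite hD.
Qed.

Lemma gringE w : w = \sum_(g <- gsupp w) gdelta (gcoef w g) g.
Proof. exact: gringEw. Qed.

Lemma gsuppU r g : (gsupp (gdelta r g) `<=` [fset g])%fset.
Proof.
apply/fsubsetP => h; rewrite mem_gsupp gdeltaE in_fset1.
by case: (h == g) => //; rewrite eqxx.
Qed.

Lemma gsuppD v w : (gsupp (v + w)%R `<=` gsupp v `|` gsupp w)%fset.
Proof.
apply/fsubsetP => g; rewrite in_fsetU !mem_gsupp gcoefD -negb_and.
by apply: contra => /andP[/eqP -> /eqP ->]; rewrite addr0.
Qed.

Definition gone : RG := gdelta 1 1%g.

Definition gmul v w : RG :=
  \sum_(g <- gsupp v) \sum_(h <- gsupp w)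
    gdelta (gcoef v g * gcoef w h) (g * h)%g.

Lemma gmulw (D1 D2 : {fset G}) v w :
  (gsupp v `<=` D1)%fset -> (gsupp w `<=` D2)%fset ->
  gmul v w = \sum_(g <- D1) \sum_(h <- D2)
    gdelta (gcoef v g * gcoef w h) (g * h)%g.
Proof.
move=> vD wD; rewrite /gmul (big_fset_incl _ vD) /=.
  apply: eq_bigr => g _; apply: big_fset_incl => // h _ /gsupp_out ->.
  by rewrite mulr0 gdelta0.
move=> g _ /gsupp_out vg.
by rewrite big1 // => h _; rewrite vg mul0r gdelta0.
Qed.

Lemma gmulDl : left_distributive gmul +%R.
Proof.
move=> u v w; pose D := (gsupp u `|` gsupp v)%fset.
rewrite (gmulw (gsuppD u v) (fsubset_refl _)).
rewrite (gmulw (fsubsetUl _ (gsupp v)) (fsubset_refl (gsupp w))).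
rewrite (gmulw (fsubsetUr (gsupp u) _) (fsubset_refl (gsupp w))).
rewrite -big_split; apply: eq_bigr => g _.
rewrite -big_split; apply: eq_bigr => h _.
by rewrite /= gcoefD mulrDl gdeltaD.
Qed.

Lemma gmulDr : right_distributive gmul +%R.
Proof.
move=> w u v.
rewrite (gmulw (fsubset_refl _) (gsuppD u v)).
rewrite (gmulw (fsubset_refl (gsupp w)) (fsubsetUl _ (gsupp v))).
rewrite (gmulw (fsubset_refl (gsupp w)) (fsubsetUr (gsupp u) _)).
rewrite -big_split; apply: eq_bigr => g _.
rewrite -big_split; apply: eq_bigr => h _.
by rewrite /= gcoefD mulrDr gdeltaD.
Qed.

Lemma gmul0 w : gmul 0 w = 0.
Proof. by apply: (@addrI _ (gmul 0 w)); rewrite -gmulDl !addr0. Qed.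

Lemma gmulr0 w : gmul w 0 = 0.
Proof. by apply: (@addrI _ (gmul w 0)); rewrite -gmulDr !addr0. Qed.

Lemma gmulUU r s g h :
  gmul (gdelta r g) (gdelta s h) = gdelta (r * s) (g * h)%g.
Proof.
by rewrite (gmulw (gsuppU r g) (gsuppU s h)) !big_seq_fset1 !gdeltaE !eqxx.
Qed.

Lemma gring_ind (P : RG -> Prop) :
  P 0 -> (forall v w, P v -> P w -> P (v + w)) ->
  (forall r g, P (gdelta r g)) -> forall w, P w.
Proof.
by move=> P0 PD PU w; rewrite [w]gringE; elim/big_ind: _.
Qed.

Lemma gmulA : associative gmul.
Proof.
move=> u v w.
elim/gring_ind: u => [|u1 u2 IH1 IH2|r g].
- by rewrite !gmul0.
- by rewrite !gmulDl IH1 IH2.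
elim/gring_ind: v => [|v1 v2 IH1 IH2|s h].
- by rewrite !(gmul0, gmulr0).
- by rewrite !(gmulDl, gmulDr) IH1 IH2.
elim/gring_ind: w => [|w1 w2 IH1 IH2|t k].
- by rewrite !gmulr0.
- by rewrite !gmulDr IH1 IH2.
by rewrite !gmulUU mulrA mulgA.
Qed.

Lemma gmul1 : left_id gone gmul.
Proof.
elim/gring_ind => [|u1 u2 IH1 IH2|r g].
- by rewrite gmulr0.
- by rewrite gmulDr IH1 IH2.
by rewrite gmulUU mul1r mul1g.
Qed.

Lemma gmulr1 : right_id gone gmul.
Proof.
elim/gring_ind => [|u1 u2 IH1 IH2|r g].
- by rewrite gmul0.
- by rewrite gmulDl IH1 IH2.
by rewrite gmulUU mulr1 mulg1.
Qed.

Lemma gone_neq0 : gone != 0.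
Proof.
apply/eqP => /(congr1 (gcoef^~ 1%g)) /eqP.
by rewrite gdeltaE eqxx gcoef0 oner_eq0.
Qed.

HB.instance Definition _ := GRing.Zmodule_isNzRing.Build RG
  gmulA gmul1 gmulr1 gmulDl gmulDr gone_neq0.

Lemma gdeltaM r s g h :
  gdelta r g * gdelta s h = gdelta (r * s) (g * h)%g :> RG.
Proof. exact: gmulUU. Qed.

Lemma gdelta1 : gdelta 1 1%g = 1 :> RG.
Proof. by []. Qed.

End GroupRing.

Arguments gdelta {R G} r g.

(* The additive extension Z[F] -> V of a map F -> V. *)
Section Extension.
Variables (F : groupType) (V : zmodType).
Implicit Type f : F -> V.

Definition zext f (w : gring int F) : V :=
  \sum_(g <- gsupp w) f g *~ gcoef w g.

Lemma zextw f (D : {fset F}) w : (gsupp w `<=` D)%fset ->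
  zext f w = \sum_(g <- D) f g *~ gcoef w g.
Proof.
by move=> wD; apply: big_fset_incl => // g _ /gsupp_out ->; rewrite mulr0z.
Qed.

Lemma zextD f v w : zext f (v + w) = zext f v + zext f w.
Proof.
rewrite (zextw f (gsuppD v w)) (zextw f (fsubsetUl _ (gsupp w))).
rewrite (zextw f (fsubsetUr (gsupp v) _)) -big_split.
by apply: eq_bigr => g _; rewrite /= gcoefD mulrzDr.
Qed.

Lemma zext0 f : zext f 0 = 0.
Proof. by apply: (@addrI _ (zext f 0)); rewrite -zextD !addr0. Qed.

Lemma zext_is_additive f : additive (zext f).
Proof.
move=> v w; apply: (@addIr _ (zext f w)).
by rewrite -zextD subrK addrNK.
Qed.

HB.instance Definition _ f :=
  GRing.isAdditive.Build (gring int F) V (zext f) (zext_is_additive f).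

Lemma zextU f r g : zext f (gdelta r g) = f g *~ r.
Proof. by rewrite (zextw f (gsuppU r g)) big_seq_fset1 gdeltaE eqxx. Qed.

Lemma zext1 f g : zext f (gdelta 1 g) = f g.
Proof. by rewrite zextU. Qed.

End Extension.

Section ExtensionRing.
Variables (F : groupType) (A : nzRingType) (f : F -> A).
Hypothesis f1 : f 1%g = 1.
Hypothesis fM : forall u v, f (u * v)%g = f u * f v.

Lemma zext_is_morphism : GRing.monoid_morphism (zext f).
Proof.
split=> [|v w]; first by rewrite -gdelta1 zext1.
elim/gring_ind: v => [|v1 v2 IH1 IH2|r g].
- by rewrite mul0r !zext0 mul0r.
- by rewrite mulrDl !zextD IH1 IH2 mulrDl.
elim/gring_ind: w => [|w1 w2 IH1 IH2|s h].
- by rewrite mulr0 !zext0 mulr0.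
- by rewrite mulrDr !zextD IH1 IH2 mulrDr.
by rewrite gdeltaM !zextU fM mulrzAl mulrzAr -mulrzA [(s * r)%R]mulrC.
Qed.

End ExtensionRing.

Section Ell2.
Variables (R : realType) (G : groupType).
Local Notation C := R[i].
Implicit Types (f : G -> C) (z : C).

Definition sqmod z : R := ComplexField.Normc.normc z ^+ 2.

Lemma sqmodE z : sqmod z = complex.Re z ^+ 2 + complex.Im z ^+ 2.
Proof. by case: z => a b; rewrite /sqmod /= sqr_sqrtr // addr_ge0 ?sqr_ge0. Qed.

Lemma sqmod_ge0 z : 0 <= sqmod z.
Proof. exact: sqr_ge0. Qed.

Lemma sqmodM z1 z2 : sqmod (z1 * z2) = sqmod z1 * sqmod z2.
Proof. by rewrite /sqmod ComplexField.Normc.normcM exprMn. Qed.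

Lemma sqmod0 : sqmod 0 = 0.
Proof. by rewrite sqmodE /= expr0n addr0. Qed.

Lemma sqmodD z1 z2 : sqmod (z1 + z2) <= 2 * (sqmod z1 + sqmod z2).
Proof.
rewrite !sqmodE; case: z1 z2 => [a b] [c d] /=.
rewrite -subr_ge0; apply: le_trans (_ : (a - c) ^+ 2 + (b - d) ^+ 2 <= _).
  by rewrite addr_ge0 ?sqr_ge0.
by rewrite le_eqVlt; apply/orP; left; apply/eqP; ring.
Qed.

Definition sqsum f : \bar R := \esum_(g in [set: G]) (sqmod (f g))%:E.

Lemma sqsum_ge0 f : (0 <= sqsum f)%E.
Proof. by apply: esum_ge0 => g _; rewrite lee_fin sqmod_ge0. Qed.

Lemma sqsum_fin f : (sqsum f < +oo)%E -> (fine (sqsum f))%:E = sqsum f.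
Proof. by move=> fo; rewrite fineK // ge0_fin_numE // sqsum_ge0. Qed.

Lemma sqsumD f1 f2 :
  (sqsum (fun g => (f1 g + f2 g)%R) <= 2%:E * (sqsum f1 + sqsum f2))%E.
Proof.
rewrite /sqsum -esumD; try by move=> g _; rewrite lee_fin sqmod_ge0.
rewrite [in leRHS](_ : 2%:E = 1%:E + 1%:E)%E // ge0_muleDl ?lee_fin //.
rewrite mul1e -esumD; try by move=> g _; rewrite -EFinD lee_fin addr_ge0 ?sqmod_ge0.
by apply: le_esum => g _; rewrite -!EFinD lee_fin -mulr2n -mulr_natl sqmodD.
Qed.

Lemma sqsumZ (c : C) f : (sqsum f < +oo)%E ->
  (sqsum (fun g => (c * f g)%R) <= (sqmod c)%:E * sqsum f)%E.
Proof.
move=> fo; apply: ge_ereal_sup => _ [X [finX XT]] <-.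
apply: (@le_trans _ _ ((sqmod c)%:E * \sum_(g \in X) (sqmod (f g))%:E)%E).
  rewrite ge0_mule_fsumr; last by move=> g; rewrite lee_fin sqmod_ge0.
  by apply: lee_fsum => // g _; rewrite -EFinM sqmodM.
rewrite lee_wpmul2l ?lee_fin ?sqmod_ge0 //.
by apply: ereal_sup_ubound; exists X.
Qed.

Definition ell2_pred : {pred G -> C} := fun f => `[< (sqsum f < +oo)%E >].

Lemma ell2_predP f : reflect (sqsum f < +oo)%E (f \in ell2_pred).
Proof. exact: asboolP. Qed.

Lemma ell2_closed : GRing.subsemimod_closed ell2_pred.
Proof.
split; [split|].
- apply/ell2_predP; rewrite /sqsum esum1 ?ltry // => g _.
  by rewrite sqmod0.
- move=> f1 f2 /ell2_predP f1o /ell2_predP f2o; apply/ell2_predP.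
  apply: le_lt_trans (sqsumD f1 f2) _.
  by rewrite -(sqsum_fin f1o) -(sqsum_fin f2o) -EFinD -EFinM ltry.
- move=> c f /ell2_predP fo; apply/ell2_predP.
  apply: le_lt_trans (sqsumZ c fo) _.
  by rewrite -(sqsum_fin fo) -EFinM ltry.
Qed.

HB.instance Definition _ :=
  GRing.isSubmodClosed.Build C (G -> C) ell2_pred ell2_closed.

Record ell2 := Ell2 { ell2_val :> G -> C; ell2_valP : ell2_val \in ell2_pred }.

HB.instance Definition _ := [isSub for ell2_val].
HB.instance Definition _ := [Choice of ell2 by <:].
HB.instance Definition _ := [SubChoice_isSubLmodule of ell2 by <:].

Implicit Types a b : ell2.

Lemma ell2_ext a b : (forall g, a g = b g) -> a = b.
Proof. by move=> ab; apply/val_inj/funext. Qed.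

Lemma ell2DE a b g : (a + b) g = a g + b g. Proof. by []. Qed.
Lemma ell2ZE c a g : (c *: a) g = c * a g. Proof. by []. Qed.
Lemma ell2_0E g : (0 : ell2) g = 0. Proof. by []. Qed.

Lemma ell2_sumE I (s : seq I) (P : pred I) (F : I -> ell2) g :
  (\sum_(i <- s | P i) F i) g = \sum_(i <- s | P i) F i g.
Proof. by apply: (big_morph (fun a : ell2 => a g)). Qed.

Definition ell2_norm a : R := Num.sqrt (fine (sqsum a)).

Lemma ell2_norm_ge0 a : 0 <= ell2_norm a.
Proof. exact: sqrtr_ge0. Qed.

Lemma ell2_normE a : (ell2_norm a ^+ 2)%:E = sqsum a.
Proof.
rewrite sqr_sqrtr ?fine_ge0 ?sqsum_ge0 //.
exact/sqsum_fin/ell2_predP/ell2_valP.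
Qed.

Lemma ell2_normD a b :
  ell2_norm (a + b) ^+ 2 <= 2 * (ell2_norm a ^+ 2 + ell2_norm b ^+ 2).
Proof. by rewrite -lee_fin [leRHS]EFinM (EFinD (ell2_norm a ^+ 2)) !ell2_normE; apply: (sqsumD a b). Qed.

Lemma ell2_normZ c a : ell2_norm (c *: a) ^+ 2 <= sqmod c * ell2_norm a ^+ 2.
Proof.
rewrite -lee_fin [leRHS]EFinM !ell2_normE; apply: (@sqsumZ c a).
exact/ell2_predP/ell2_valP.
Qed.

Lemma ell2_norm0 : ell2_norm 0 = 0.
Proof.
apply/eqP; rewrite -sqrf_eq0; apply/eqP/EFin_inj; rewrite ell2_normE.
by rewrite /sqsum esum1 // => g _; rewrite sqmod0.
Qed.

Lemma sqsum_rtrans f h : sqsum (fun g => f (g * h^-1)%g) = sqsum f.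
Proof.
rewrite /sqsum [RHS](@reindex_esum _ _ _ setT setT (fun g => g * h^-1)%g) //.
split=> // [g1 g2 _ _ /mulIg //|g _]; exists (g * h)%g => //.
by rewrite mulgK.
Qed.

Lemma rtrans_subproof a h : (fun g => a (g * h^-1)%g) \in ell2_pred.
Proof.
apply/ell2_predP; rewrite sqsum_rtrans; exact/ell2_predP/ell2_valP.
Qed.

(* R_h, the extension of g |-> g h; see rtrans_delta. *)
Definition rtrans h a : ell2 := Ell2 (rtrans_subproof a h).

Lemma rtrans_linear h : linear (rtrans h).
Proof. by move=> c a b; apply: ell2_ext. Qed.

HB.instance Definition _ h :=
  GRing.isLinear.Build C ell2 ell2 *:%R (rtrans h) (rtrans_linear h).

Lemma rtrans_norm h a : ell2_norm (rtrans h a) = ell2_norm a.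
Proof. by rewrite /ell2_norm sqsum_rtrans. Qed.

Lemma rtransM h k a : rtrans (h * k)%g a = rtrans k (rtrans h a).
Proof. by apply: ell2_ext => g /=; rewrite invgM mulgA. Qed.

Lemma rtrans1 a : rtrans 1%g a = a.
Proof. by apply: ell2_ext => g /=; rewrite invg1 mulg1. Qed.

Lemma edelta_subproof g : (fun x => (x == g)%:R : C) \in ell2_pred.
Proof.
apply/ell2_predP; rewrite /sqsum (esumID [set g]); last first.
  by move=> x _; rewrite lee_fin sqmod_ge0.
rewrite [X in (_ + X)%E]esum1 => [|x [_ /= /eqP/negPf ->]]; last by rewrite sqmod0.
rewrite setTI esum_set1 ?lee_fin ?sqmod_ge0 //.
by rewrite adde0 ltry.
Qed.

Definition edelta g : ell2 := Ell2 (edelta_subproof g).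

Lemma rtrans_delta h g : rtrans h (edelta g) = edelta (g * h)%g.
Proof.
by apply: ell2_ext => x /=; rewrite -(can_eq (mulgK h)) mulgVK.
Qed.

End Ell2.

Record bop (R : realType) (V : lmodType R[i]) (N : V -> R) := Bop {
  bop_fun :> V -> V;
  bop_linear : linear bop_fun;
  bop_bounded : exists M : R, forall v, N (bop_fun v) <= M * N v }.

Section BoundedOps.
Variables (R : realType) (V : lmodType R[i]) (N : V -> R).

HB.instance Definition _ (S : bop N) :=
  GRing.isLinear.Build R[i] V V *:%R S (bop_linear S).

Lemma bop_ext (S T : bop N) : S =1 T -> S = T.
Proof.
case: S T => [S Sl SM] [T Tl TM] /= ST.
have e : S = T by apply/funext.
by subst T; congr Bop; apply: Prop_irrelevance.
Qed.

Hypothesis N_ge0 : forall v, 0 <= N v.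

Lemma bounded_sq (S : V -> V) :
  (exists M : R, forall v, N (S v) <= M * N v) <->
  (exists M : R, 0 <= M /\ forall v, N (S v) ^+ 2 <= M * N v ^+ 2).
Proof.
split=> [[M SM]|[M [M0 SM]]].
  exists (M ^+ 2); split=> [|v]; first exact: sqr_ge0.
  by rewrite -exprMn lerXn2r ?nnegrE ?N_ge0 // (le_trans _ (SM v)).
exists (Num.sqrt M) => v.
rewrite -(@ler_pXn2r _ 2) ?nnegrE ?N_ge0 ?mulr_ge0 ?sqrtr_ge0 //.
by rewrite exprMn sqr_sqrtr.
Qed.

End BoundedOps.

Section GroupOps.
Variables (R : realType) (G : groupType).
Local Notation C := R[i].
Local Notation H := (ell2 R G).
Local Notation BH := (bop (@ell2_norm R G)).
Implicit Types (a b : H) (w : gring C G).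

Definition rop_fun w a : H := \sum_(h <- gsupp w) gcoef w h *: rtrans h a.

Lemma rop_linear w : linear (rop_fun w).
Proof.
move=> c a b; rewrite /rop_fun scaler_sumr -big_split; apply: eq_bigr => h _.
by rewrite linearP scalerDr !scalerA mulrC.
Qed.

Lemma ell2_bounded_sum (V : Type) (N : V -> R) (I : Type) (s : seq I)
    (F : I -> V -> H) :
  (forall i, exists M : R, 0 <= M /\
     forall v, ell2_norm (F i v) ^+ 2 <= M * N v ^+ 2) ->
  exists M : R, 0 <= M /\
     forall v, ell2_norm (\sum_(i <- s) F i v) ^+ 2 <= M * N v ^+ 2.
Proof.
move=> FM; elim: s => [|i s [M [M0 sM]]].
  by exists 0; split=> // v; rewrite big_nil ell2_norm0 expr0n mul0r.
have [K [K0 iK]] := FM i; exists (2 * (K + M)); split=> [|v].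
  by rewrite mulr_ge0 ?addr_ge0.
rewrite big_cons; apply: le_trans (ell2_normD _ _) _.
by rewrite -mulrA ler_wpM2l // [leRHS]mulrDl lerD.
Qed.

Lemma rop_bounded w : exists M : R,
  forall a, ell2_norm (rop_fun w a) <= M * ell2_norm a.
Proof.
apply/bounded_sq; first exact: ell2_norm_ge0.
apply: ell2_bounded_sum => h; exists (sqmod (gcoef w h)).
split=> [|a]; first exact: sqmod_ge0.
by apply: le_trans (ell2_normZ _ _) _; rewrite rtrans_norm.
Qed.

Definition rop w : BH := Bop (@rop_linear w) (rop_bounded w).

Lemma rop_w (D : {fset G}) w a : (gsupp w `<=` D)%fset ->
  rop w a = \sum_(h <- D) gcoef w h *: rtrans h a.
Proof.
by move=> wD; apply: big_fset_incl => // h _ /gsupp_out ->; rewrite scale0r.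
Qed.

Lemma ropD v w a : rop (v + w) a = rop v a + rop w a.
Proof.
rewrite (rop_w _ (gsuppD v w)) (rop_w _ (fsubsetUl _ (gsupp w))).
rewrite (rop_w _ (fsubsetUr (gsupp v) _)) -big_split.
by apply: eq_bigr => h _; rewrite /= gcoefD scalerDl.
Qed.

Lemma rop0 a : rop 0 a = 0.
Proof. by apply: (@addrI _ (rop 0 a)); rewrite -ropD !addr0. Qed.

Lemma ropU c h a : rop (gdelta c h) a = c *: rtrans h a.
Proof. by rewrite (rop_w _ (gsuppU c h)) big_seq_fset1 gdeltaE eqxx. Qed.

Lemma ropM v w a : rop (v * w) a = rop w (rop v a).
Proof.
elim/gring_ind: v => [|v1 v2 IH1 IH2|c h].
- by rewrite mul0r !rop0 linear0.
- by rewrite mulrDl !ropD IH1 IH2 linearD.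
elim/gring_ind: w => [|w1 w2 IH1 IH2|d k].
- by rewrite mulr0 !rop0.
- by rewrite mulrDr !ropD IH1 IH2.
by rewrite gdeltaM !ropU rtransM linearZ scalerA mulrC.
Qed.

(* mxop and opmx below are the two inverse directions of the identification of
   M_n(B(l^2(G))) with B(l^2(G)^n). *)
Variable n : nat.

Definition ell2n : Type := {ffun 'I_n -> H}.
HB.instance Definition _ := GRing.Lmodule.on ell2n.
Implicit Types u v : ell2n.

Definition ell2n_norm v : R := Num.sqrt (\sum_i ell2_norm (v i) ^+ 2).
Local Notation BHn := (bop ell2n_norm).

Lemma ell2n_norm_ge0 v : 0 <= ell2n_norm v.
Proof. exact: sqrtr_ge0. Qed.

Lemma ell2n_normE v : ell2n_norm v ^+ 2 = \sum_i ell2_norm (v i) ^+ 2.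
Proof. by rewrite sqr_sqrtr // sumr_ge0 // => i _; rewrite sqr_ge0. Qed.

Lemma ell2n_norm_coord v i : ell2_norm (v i) ^+ 2 <= ell2n_norm v ^+ 2.
Proof.
by rewrite ell2n_normE (bigD1 i) //= lerDl sumr_ge0 // => j _; rewrite sqr_ge0.
Qed.

Definition einj (i : 'I_n) a : ell2n := [ffun j => if j == i then a else 0].

Lemma einj_linear i : linear (einj i).
Proof.
move=> c a b; apply/ffunP => j; rewrite !ffunE; case: eqP => // _.
by rewrite scaler0 addr0.
Qed.

HB.instance Definition _ i :=
  GRing.isLinear.Build C H ell2n *:%R (einj i) (einj_linear i).

Lemma einj_norm i a : ell2n_norm (einj i a) ^+ 2 = ell2_norm a ^+ 2.
Proof.
rewrite ell2n_normE (bigD1 i) //= ffunE eqxx big1 ?addr0 // => j /negPf ji.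
by rewrite ffunE ji ell2_norm0 expr0n.
Qed.

Lemma ell2nE v : v = \sum_i einj i (v i).
Proof.
apply/ffunP => j; rewrite sum_ffunE (bigD1 j) //= ffunE eqxx.
by rewrite big1 ?addr0 // => i /negPf ij; rewrite ffunE eq_sym ij.
Qed.

Definition mxop_fun (A : 'M[BH]_n) v : ell2n :=
  [ffun i => \sum_j A i j (v j)].

Lemma mxop_linear A : linear (mxop_fun A).
Proof.
move=> c u v; apply/ffunP => i; rewrite !ffunE scaler_sumr -big_split.
by apply: eq_bigr => j _; rewrite !ffunE linearP.
Qed.

Lemma ell2n_bounded (S : ell2n -> ell2n) :
  (forall i, exists M : R, 0 <= M /\
     forall v, ell2_norm (S v i) ^+ 2 <= M * ell2n_norm v ^+ 2) ->
  exists M : R, forall v, ell2n_norm (S v) <= M * ell2n_norm v.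
Proof.
move=> SM; apply/bounded_sq; first exact: ell2n_norm_ge0.
have {SM} [M SM] := choice SM.
exists (\sum_i M i); split=> [|v].
  by rewrite sumr_ge0 // => i _; case: (SM i).
rewrite ell2n_normE mulr_suml; apply: ler_sum => i _.
by case: (SM i).
Qed.

Lemma bop_sq (A : BH) : exists M : R, 0 <= M /\
  forall a, ell2_norm (A a) ^+ 2 <= M * ell2_norm a ^+ 2.
Proof. by apply/bounded_sq; [apply: ell2_norm_ge0 | apply: bop_bounded]. Qed.

Lemma mxop_bounded A : exists M : R,
  forall v, ell2n_norm (mxop_fun A v) <= M * ell2n_norm v.
Proof.
apply: ell2n_bounded => i.
under eq_exists do under eq_forall do rewrite ffunE.
apply: ell2_bounded_sum => j; have [M [M0 AM]] := bop_sq (A i j).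
exists M; split=> // v; apply: le_trans (AM _) _.
by rewrite ler_wpM2l // ell2n_norm_coord.
Qed.

Definition mxop (A : 'M[BH]_n) : BHn := Bop (@mxop_linear A) (mxop_bounded A).

Definition opentry_fun (S : BHn) (i j : 'I_n) a : H := S (einj j a) i.

Lemma opentry_linear S i j : linear (opentry_fun S i j).
Proof. by move=> c a b; rewrite /opentry_fun !linearP !ffunE. Qed.

Lemma opentry_bounded S i j : exists M : R,
  forall a, ell2_norm (opentry_fun S i j a) <= M * ell2_norm a.
Proof.
apply/bounded_sq; first exact: ell2_norm_ge0.
have /bounded_sq [|M [M0 SM]] := bop_bounded S; first exact: ell2n_norm_ge0.
exists M; split=> // a; apply: le_trans (ell2n_norm_coord _ _) _.
by rewrite -(einj_norm j).
Qed.

Definition opmx (S : BHn) : 'M[BH]_n :=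
  \matrix_(i, j) Bop (@opentry_linear S i j) (opentry_bounded S i j).

Lemma opmxK : cancel opmx mxop.
Proof.
move=> S; apply: bop_ext => v; apply/ffunP => i; rewrite ffunE.
rewrite [in RHS](ell2nE v) linear_sum sum_ffunE.
by apply: eq_bigr => j _; rewrite mxE.
Qed.

Lemma mxopK : cancel mxop opmx.
Proof.
move=> A; apply/matrixP => i j; rewrite mxE; apply: bop_ext => a /=.
rewrite /opentry_fun ffunE (bigD1 j) //= ffunE eqxx big1 ?addr0 // => k kj.
by rewrite ffunE (negPf kj) linear0.
Qed.

End GroupOps.

Definition zmult : groupType := Algebra.to_multiplicative int.

Definition Tgen : zmult := (1%R : int).

(* Z[T, T^-1] is the group ring of the infinite cyclic group, T being the
   generator 1. *)
Definition laurent : nzRingType := gring int zmult.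

Definition zelt (G : groupType) (g : G) : gring int G := gdelta 1 g.

Lemma zeltM (G : groupType) (g h : G) : zelt (g * h)%g = zelt g * zelt h.
Proof. by rewrite /zelt gdeltaM mulr1. Qed.

Lemma zelt1 (G : groupType) : zelt (1%g : G) = 1.
Proof. by []. Qed.

Section Fox.
Variable n : nat.
Local Notation F := (freegrp n).
Local Notation ZF := (gring int F).
Implicit Types (u v : F) (w : word 'I_n) (i j : 'I_n).

Definition phi : F -> zmult := free_lift (fun=> Tgen).

Definition Tphi : ZF -> laurent := zext (fun u => zelt (phi u)).

Lemma phiM u v : phi (u * v)%g = (phi u * phi v)%g.
Proof. exact: gmulfM. Qed.

Lemma phiV u : phi u^-1%g = (phi u)^-1%g.
Proof. exact: gmulfV. Qed.

Lemma phi_gen i : phi (xgen i) = Tgen.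
Proof. exact: free_lift_gen. Qed.

Lemma Tphi_morph : GRing.monoid_morphism Tphi.
Proof.
apply: zext_is_morphism; first by rewrite /phi gmulf1.
by move=> u v; rewrite phiM zeltM.
Qed.

Lemma phi_artin (beta : braid n) u : phi (artin beta u) = phi u.
Proof.
rewrite -(prepr beta); elim: (repr beta) u => [|[i b] w IH] u.
  by rewrite pclass_nil /artin (pres_lift_morph (@artin_rel n)).1.
have key k : phi \o artin_gen k =1 phi.
  apply: free_ext => [||j].
  - by move=> x y; rewrite /= artin_funM phiM.
  - exact: phiM.
  rewrite /= /artin_fun free_lift_gen.
  case: eqP => [->|_]; last by case: eqP => [->|//]; rewrite !phi_gen.
  by rewrite !phiM phiV !phi_gen mulgK.
rewrite -cat1s pclassM artinM IH.
have -> : artin (pclass (@braid_rel n) [:: (i, b)]) =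
    letter_eval (@artin_gen n) (i, b).
  by rewrite /artin (pres_lift_class (@artin_rel n)) /= mulg1.
rewrite /letter_eval /=.
case: b; first exact: key.
by rewrite -[LHS](key i) /= artin_invK.
Qed.

Definition letter (l : 'I_n * bool) : F := letter_eval (@xgen n) l.

Definition fox_letter j (l : 'I_n * bool) : ZF :=
  if l.1 == j then (if l.2 then 1 else - zelt (xgen j)^-1%g) else 0.

Fixpoint fox_word j w : ZF :=
  if w is l :: w' then fox_letter j l + zelt (letter l) * fox_word j w' else 0.

(* d/dx_j, characterised by linearity, fox_gen and foxM below. *)
Definition fox j : ZF -> ZF := zext (fun u => fox_word j (repr u)).

Lemma word_evalE w : word_eval (@xgen n) w = pclass (@no_rel n) w.
Proof.
by rewrite -(free_lift_class (@xgen n)) -(@free_lift_eq _ _ id).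
Qed.

Lemma fox_word_cat j (v w : word 'I_n) : fox_word j (v ++ w) =
  fox_word j v + zelt (pclass (@no_rel n) v) * fox_word j w.
Proof.
elim: v => [|l v IH] /=; first by rewrite pclass_nil zelt1 mul1r add0r.
rewrite IH mulrDr mulrA -zeltM addrA; congr (_ + zelt _ * _).
by rewrite -!word_evalE.
Qed.

Lemma fox_word_eq j (v w : word 'I_n) :
  pres_eq (@no_rel n) v w -> fox_word j v = fox_word j w.
Proof.
elim=> {v w} // [u v w _ -> _ -> //|u v x b].
rewrite !fox_word_cat; congr (_ + _ * _) => /=.
rewrite mulrDr addrA mulrA -zeltM /letter /letter_eval /fox_letter /=.
have -> : (letter (x, b) * letter (x, ~~ b))%g = 1%g.
  by case: b; rewrite /letter /letter_eval /= ?mulgV ?mulVg.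
rewrite zelt1 mul1r -[RHS]add0r; congr (_ + _).
case: eqP => [<-|_]; last by rewrite mulr0 addr0.
case: b => /=; last by rewrite mulr1 addNr.
by rewrite mulrN -zeltM mulgV zelt1 subrr.
Qed.

Lemma fox_class j w : fox j (zelt (pclass (@no_rel n) w)) = fox_word j w.
Proof. by rewrite /fox zext1; apply: fox_word_eq; apply: pres_reprK. Qed.

Lemma fox_gen i j : fox j (zelt (xgen i)) = (i == j)%:R.
Proof.
by rewrite fox_class /= mulr0 addr0 /fox_letter /=; case: (i == j).
Qed.

Lemma foxM j u v :
  fox j (zelt (u * v)%g) = fox j (zelt u) + zelt u * fox j (zelt v).
Proof.
by rewrite -(prepr u) -(prepr v) -pclassM !fox_class fox_word_cat.
Qed.

Definition burau (beta : braid n) : 'M[laurent]_n :=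
  \matrix_(i, j) Tphi (fox j (zelt (artin beta (xgen i)))).

(* C_1 of the universal cover relative to the fibre of z, i.e. the free left
   Z[F_n]-module on the lifts of the x_i: D_n retracts onto the wedge of the
   loops x_i, whose universal cover is the Cayley tree of F_n; the fibre of z
   is F_n and the translate g . xlift i is the edge from g to g x_i. *)
Definition chain1 : Type := 'rV[ZF]_n.
Implicit Types c d : chain1.

Definition xlift i : chain1 := delta_mx 0 i.

(* The oriented edge traversed from the vertex g by the letter x_i^(+-1). *)
Definition edge (g : F) (l : 'I_n * bool) : chain1 :=
  if l.2 then zelt g *: xlift l.1
  else - (zelt (g * (xgen l.1)^-1)%g *: xlift l.1).

Fixpoint edge_path (g : F) w : chain1 :=
  if w is l :: w' then edge g l + edge_path (g * letter l)%g w' else 0.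

(* The lift, starting at the base vertex, of a loop in the class u. *)
Definition path_lift u : chain1 := edge_path 1%g (repr u).

Lemma edge_path_cat g (v w : word 'I_n) : edge_path g (v ++ w) =
  edge_path g v + edge_path (g * pclass (@no_rel n) v)%g w.
Proof.
elim: v g => [|l v IH] g /=; first by rewrite pclass_nil mulg1 add0r.
rewrite IH addrA; congr (_ + edge_path _ _).
by rewrite -mulgA -!word_evalE.
Qed.

Lemma edge_path_translate g h w :
  edge_path (g * h)%g w = zelt g *: edge_path h w.
Proof.
elim: w h => [|l w IH] h /=; first by rewrite scaler0.
rewrite -mulgA IH scalerDr; congr (_ + _); rewrite /edge.
by case: l.2; rewrite ?scalerN scalerA -zeltM ?mulgA.
Qed.

Lemma edge_path_eq g (v w : word 'I_n) :
  pres_eq (@no_rel n) v w -> edge_path g v = edge_path g w.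
Proof.
move=> vw; elim: vw g => {v w} // [u v w _ uv _ vw g|u v x b g].
  by rewrite uv.
rewrite !edge_path_cat; congr (_ + _) => /=.
move: (g * _)%g => {}g; rewrite -(mulgA g).
have -> : (letter (x, b) * letter (x, ~~ b))%g = 1%g.
  by case: b; rewrite /letter /letter_eval /= ?mulgV ?mulVg.
rewrite mulg1 addrA /edge /letter /letter_eval.
by case: b; rewrite /= ?mulgK ?subrr ?addNr add0r.
Qed.

Lemma path_lift_class w : path_lift (pclass (@no_rel n) w) = edge_path 1%g w.
Proof. by apply: edge_path_eq; apply: pres_reprK. Qed.

Lemma path_lift_gen i : path_lift (xgen i) = xlift i.
Proof. by rewrite path_lift_class /= addr0 /edge /= zelt1 scale1r. Qed.

Lemma path_liftM u v : path_lift (u * v)%g = path_lift u + zelt u *: path_lift v.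
Proof.
rewrite -(prepr u) -(prepr v) -pclassM !path_lift_class edge_path_cat mul1g.
by rewrite -edge_path_translate mulg1.
Qed.

Lemma path_lift1 : path_lift 1%g = 0.
Proof. by rewrite -pclass_nil path_lift_class. Qed.

Lemma path_liftV u : path_lift u^-1%g = - (zelt u^-1%g *: path_lift u).
Proof.
by apply/eqP; rewrite -addr_eq0 -path_liftM mulVg path_lift1.
Qed.

(* x~_i runs from the vertex 1 to the vertex x_i. *)
Definition boundary c : ZF := \sum_i c 0 i * (zelt (xgen i) - 1).

Lemma boundary_linear : linear_for *%R boundary.
Proof.
move=> r c d; rewrite /boundary mulr_sumr -big_split; apply: eq_bigr => i _.
by rewrite !mxE mulrDl mulrA.
Qed.

HB.instance Definition _ :=
  GRing.isLinear.Build ZF chain1 ZF *%R boundary boundary_linear.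

Lemma boundary_xlift i : boundary (xlift i) = zelt (xgen i) - 1.
Proof.
rewrite /boundary (bigD1 i) //= mxE !eqxx mul1r big1 ?addr0 // => j ji.
by rewrite mxE (negPf ji) andbF mul0r.
Qed.

Lemma boundary_edge g l : boundary (edge g l) = zelt (g * letter l)%g - zelt g.
Proof.
rewrite /edge /letter /letter_eval; case: l => i [] /=; rewrite ?linearN.
  by rewrite linearZ /= boundary_xlift mulrBr mulr1 -zeltM.
by rewrite linearZ /= boundary_xlift mulrBr mulr1 -zeltM mulgVK opprB.
Qed.

Lemma boundary_edge_path g w : boundary (edge_path g w) =
  zelt (g * pclass (@no_rel n) w)%g - zelt g.
Proof.
elim: w g => [|l w IH] g /=; first by rewrite pclass_nil mulg1 linear0 subrr.
rewrite linearD /= boundary_edge IH -!word_evalE /= mulgA.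
by rewrite addrC addrA subrK.
Qed.

Lemma boundary_path_lift u : boundary (path_lift u) = zelt u - 1.
Proof. by rewrite boundary_edge_path mul1g prepr zelt1. Qed.

Definition artinZ (beta : braid n) : ZF -> ZF :=
  zext (fun u => zelt (artin beta u)).

(* The h_beta-semilinear map of C_1 induced by the lift of H_beta fixing the
   base vertex: it maps the lift of x_i to the lift of h_beta(x_i). *)
Definition braid_lift (beta : braid n) c : chain1 :=
  \sum_i artinZ beta (c 0 i) *: path_lift (artin beta (xgen i)).

Lemma artinZ_morph beta : GRing.monoid_morphism (artinZ beta).
Proof.
apply: zext_is_morphism; first by rewrite gaut_f1.
by move=> u v; rewrite gaut_M zeltM.
Qed.

Lemma artinZ_zelt beta u : artinZ beta (zelt u) = zelt (artin beta u).
Proof. exact: zext1. Qed.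

Lemma braid_liftD beta c d :
  braid_lift beta (c + d) = braid_lift beta c + braid_lift beta d.
Proof.
rewrite /braid_lift -big_split; apply: eq_bigr => i _.
by rewrite /= mxE /artinZ zextD scalerDl.
Qed.

Lemma braid_liftZ beta (r : ZF) c :
  braid_lift beta (r *: c) = artinZ beta r *: braid_lift beta c.
Proof.
rewrite /braid_lift scaler_sumr; apply: eq_bigr => i _.
by rewrite mxE (artinZ_morph beta).2 scalerA.
Qed.

Lemma braid_lift0 beta : braid_lift beta 0 = 0.
Proof.
by apply: (@addrI _ (braid_lift beta 0)); rewrite -braid_liftD !addr0.
Qed.

Lemma braid_liftN beta c : braid_lift beta (- c) = - braid_lift beta c.
Proof. by apply/eqP; rewrite -addr_eq0 -braid_liftD addNr braid_lift0. Qed.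

Lemma braid_lift_xlift beta i :
  braid_lift beta (xlift i) = path_lift (artin beta (xgen i)).
Proof.
rewrite /braid_lift (bigD1 i) //= mxE !eqxx (artinZ_morph beta).1 scale1r.
rewrite big1 ?addr0 // => j ji.
by rewrite mxE (negPf ji) andbF /artinZ zext0 scale0r.
Qed.

Lemma braid_lift_edge beta g l : braid_lift beta (edge g l) =
  zelt (artin beta g) *: path_lift (artin beta (letter l)).
Proof.
rewrite /edge /letter /letter_eval; case: l => i [] /=.
  by rewrite braid_liftZ artinZ_zelt braid_lift_xlift.
rewrite braid_liftN braid_liftZ artinZ_zelt braid_lift_xlift.
by rewrite gaut_M gaut_fV path_liftV scalerN scalerA -zeltM.
Qed.

Lemma braid_lift_edge_path beta g w : braid_lift beta (edge_path g w) =
  zelt (artin beta g) *: path_lift (artin beta (pclass (@no_rel n) w)).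
Proof.
elim: w g => [|l w IH] g /=.
  by rewrite braid_lift0 pclass_nil gaut_f1 path_lift1 scaler0.
rewrite braid_liftD braid_lift_edge IH -!word_evalE /= -/(letter l).
by rewrite !gaut_M path_liftM scalerDr scalerA -zeltM.
Qed.

Lemma braid_lift_path beta u :
  braid_lift beta (path_lift u) = path_lift (artin beta u).
Proof. by rewrite braid_lift_edge_path prepr gaut_f1 zelt1 scale1r. Qed.

End Fox.

Section L2Burau.
Variables (R : realType) (n : nat) (G : groupType).
Variables (t : R) (gamma : freegrp n -> G).
Local Notation C := R[i].
Local Notation F := (freegrp n).
Local Notation ZF := (gring int F).
Local Notation H := (ell2 R G).
Local Notation Hn := (ell2n R G n).
Local Notation chain1 := (chain1 n).

Definition kappa : ZF -> gring R G :=
  zext (fun u => gdelta (t ^ (phi u : int)) (gamma u)).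

Definition cgring (w : gring R G) : gring C G :=
  \sum_(g <- gsupp w) gdelta ((gcoef w g)%:C)%C g.

(* a . w, for the right Z[F_n]-module structure of l^2(G). *)
Definition l2act (a : H) (w : ZF) : H := rop (cgring (kappa w)) a.

(* The class of a (x) c in l^2(G) (x)_(Z[F_n]) C_1, under the identification
   of this tensor product with the direct sum of the l^2(G) xlift i. *)
Definition l2tens (a : H) (c : chain1) : Hn := [ffun j => l2act a (c 0 j)].

(* id (x) (the lift of H_beta), on the direct sum of the l^2(G) xlift i. *)
Definition l2lift_fun (beta : braid n) (v : Hn) : Hn :=
  \sum_i l2tens (v i) (braid_lift beta (xlift i)).

Lemma l2lift_linear beta : linear (l2lift_fun beta).
Proof.
move=> c u v; rewrite /l2lift_fun scaler_sumr -big_split; apply: eq_bigr => i _.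
by apply/ffunP => j; rewrite !ffunE /l2act linearP.
Qed.

Lemma l2lift_bounded beta : exists M : R,
  forall v, ell2n_norm (l2lift_fun beta v) <= M * ell2n_norm v.
Proof.
apply: ell2n_bounded => j.
under eq_exists do under eq_forall do rewrite sum_ffunE.
apply: ell2_bounded_sum => i.
have [M [M0 SM]] :=
  bop_sq (rop (cgring (kappa (braid_lift beta (xlift i) 0 j)))).
exists M; split=> // v; rewrite ffunE; apply: le_trans (SM _) _.
by rewrite ler_wpM2l // ell2n_norm_coord.
Qed.

Definition l2lift (beta : braid n) : bop (@ell2n_norm R G n) :=
  Bop (@l2lift_linear beta) (l2lift_bounded beta).

(* Column i is the image of the i-th summand, since matrices act on the left of
   column vectors; see burau2E below. *)
Definition burau2 (beta : braid n) : 'M[bop (@ell2_norm R G)]_n :=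
  opmx (l2lift beta).

End L2Burau.

Section L2BurauTheory.
Variables (R : realType) (n : nat) (G : groupType) (t : R).
Hypothesis t_gt0 : 0 < t.
Local Notation F := (freegrp n).
Local Notation ZF := (gring int F).
Implicit Types (w : ZF) (a : ell2 R G).

Lemma cgringE (w : gring R G) g : gcoef (cgring w) g = ((gcoef w g)%:C)%C.
Proof.
rewrite /cgring gcoef_sum [in RHS](gringE w) gcoef_sum rmorph_sum.
by apply: eq_bigr => h _; rewrite !gdeltaE; case: ifP => // _; rewrite rmorph0.
Qed.

Lemma cgringD (v w : gring R G) : cgring (v + w) = cgring v + cgring w.
Proof. by apply/gringP => g; rewrite gcoefD !cgringE gcoefD rmorphD. Qed.

Lemma cgring0 : cgring (0 : gring R G) = 0.
Proof. by apply/gringP => g; rewrite cgringE !gcoef0 rmorph0. Qed.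

Lemma cgringU r (g : G) : cgring (gdelta r g) = gdelta ((r : R)%:C)%C g.
Proof.
by apply/gringP => h; rewrite cgringE !gdeltaE; case: ifP; rewrite ?rmorph0.
Qed.

Lemma cgringM (v w : gring R G) : cgring (v * w) = cgring v * cgring w.
Proof.
elim/gring_ind: v => [|v1 v2 IH1 IH2|r g].
- by rewrite mul0r !cgring0 mul0r.
- by rewrite mulrDl !cgringD IH1 IH2 mulrDl.
elim/gring_ind: w => [|w1 w2 IH1 IH2|s h].
- by rewrite mulr0 !cgring0 mulr0.
- by rewrite mulrDr !cgringD IH1 IH2 mulrDr.
by rewrite gdeltaM !cgringU rmorphM gdeltaM.
Qed.

Lemma l2actD (gamma : F -> G) a v w :
  l2act t gamma a (v + w) = l2act t gamma a v + l2act t gamma a w.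
Proof. by rewrite /l2act /kappa zextD cgringD ropD. Qed.

Lemma l2act0 (gamma : F -> G) a : l2act t gamma a 0 = 0.
Proof. by rewrite /l2act /kappa zext0 cgring0 rop0. Qed.

Lemma l2act_sum (gamma : F -> G) a I (s : seq I) (f : I -> ZF) :
  l2act t gamma a (\sum_(i <- s) f i) = \sum_(i <- s) l2act t gamma a (f i).
Proof.
by apply: (big_morph (l2act t gamma a)); [apply: l2actD | apply: l2act0].
Qed.

Variable gamma : {multiplicative F -> G}.

Lemma kappa_morph : GRing.monoid_morphism (kappa t gamma).
Proof.
apply: zext_is_morphism => [|u v].
  have -> : phi (1%g : F) = (0 : int) by rewrite /phi gmulf1.
  by rewrite expr0z (mulg_morph1 (@gmulfM _ _ gamma)).
by rewrite phiM gmulfM gdeltaM expfzDr // gt_eqF.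
Qed.

Lemma l2actM a v w :
  l2act t gamma a (v * w) = l2act t gamma (l2act t gamma a v) w.
Proof. by rewrite /l2act kappa_morph.2 cgringM ropM. Qed.

Lemma kappa_artin beta w :
  kappa t (gamma \o artin beta) w = kappa t gamma (artinZ beta w).
Proof.
elim/gring_ind: w => [|v w IH1 IH2|r u].
- by rewrite /artinZ /kappa !zext0.
- by move: IH1 IH2; rewrite /artinZ /kappa !zextD => -> ->.
by rewrite /kappa /artinZ !zextU raddfMz /= zext1 phi_artin //.
Qed.

(* l2lift is id (x) (the lift of H_beta), from the module defined by
   gamma \o h_beta to the one defined by gamma. *)
Lemma l2lift_tens beta a (c : chain1 n) :
  l2lift t gamma beta (l2tens t (gamma \o artin beta) a c) =
  l2tens t gamma a (braid_lift beta c).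
Proof.
apply/ffunP => j; rewrite /= /l2lift_fun sum_ffunE ffunE.
rewrite {2}/braid_lift summxE l2act_sum; apply: eq_bigr => i _.
by rewrite !ffunE braid_lift_xlift mxE l2actM {2}/l2act kappa_artin.
Qed.

Lemma l2tens_xlift a i : l2tens t gamma a (xlift i) = einj i a.
Proof.
apply/ffunP => j; rewrite !ffunE mxE eqxx /=; case: eqP => _ /=.
  by rewrite /l2act kappa_morph.1 -gdelta1 cgringU ropU rtrans1 scale1r.
by rewrite l2act0.
Qed.

(* The (j, i) entry of the matrix is R_(kappa (the j-th coordinate of the image
   of xlift i)). *)
Lemma burau2E beta i j a : burau2 t gamma beta j i a =
  l2act t gamma a (braid_lift beta (xlift i) 0 j).
Proof.
rewrite mxE /= /opentry_fun /= /l2lift_fun sum_ffunE (bigD1 i) //= !ffunE eqxx.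
by rewrite big1 ?addr0 // => k ki; rewrite !ffunE (negPf ki) /l2act linear0.
Qed.

End L2BurauTheory.

(* Main.v *)
(** An entry of the L2-Burau matrix is the operator R_(kappa w), with w a Fox
    derivative of h_beta(x_i), and it recovers kappa w as the image of the basis
    vector at 1. Writing phi = psi o gamma, the sum of the coefficients of
    kappa w over the fibre of psi above k is t^k times the coefficient of T^k in
    the corresponding entry of the Burau matrix, and t^k is invertible. *)

Require Import Defs.
From HB Require Import structures.
From mathcomp Require Import all_boot all_order all_algebra.
From mathcomp Require Import finmap complex.
From mathcomp Require Import boolp classical_sets cardinality reals.

Set Implicit Arguments.
Unset Strict Implicit.
Unset Printing Implicit Defensive.

Import Order.TTheory GRing.Theory Num.Theory.
Local Open Scope ring_scope.

Section FibreSum.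
Variables (R : nzRingType) (G : groupType) (I : eqType) (f : G -> I).
Implicit Types (v w : gring R G) (k : I).

(** The coefficient at [k] of the push-forward of [w] along [f]; for a homomorphism [f], this
    push-forward is the induced map of group rings. *)
Definition fibre_sum w k : R := \sum_(g <- gsupp w | f g == k) gcoef w g.

Lemma fibre_sumw (D : {fset G}) w k : (gsupp w `<=` D)%fset ->
  fibre_sum w k = \sum_(g <- D | f g == k) gcoef w g.
Proof.
move=> wD; rewrite /fibre_sum big_mkcond [RHS]big_mkcond.
by apply: big_fset_incl => // g _ /gsupp_out ->; rewrite if_same.
Qed.

Lemma fibre_sum0 k : fibre_sum 0 k = 0.
Proof. by rewrite /fibre_sum big1 // => g _; rewrite gcoef0. Qed.

Lemma fibre_sumD v w k : fibre_sum (v + w) k = fibre_sum v k + fibre_sum w k.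
Proof.
rewrite (fibre_sumw k (gsuppD v w)) (fibre_sumw k (fsubsetUl _ (gsupp w))).
rewrite (fibre_sumw k (fsubsetUr (gsupp v) _)) -big_split.
by apply: eq_bigr => g _; rewrite /= gcoefD.
Qed.

Lemma fibre_sumU r g k : fibre_sum (gdelta r g) k = if f g == k then r else 0.
Proof.
rewrite (fibre_sumw k (gsuppU r g)) big_mkcond big_seq_fset1.
by rewrite gdeltaE eqxx.
Qed.

End FibreSum.

Lemma gdeltaMz (R : nzRingType) (G : groupType) (r : R) (g : G) (m : int) :
  gdelta r g *~ m = gdelta (r *~ m) g.
Proof.
have gdelta_additive : zmod_morphism (fun s : R => gdelta s g).
  move=> s s'; apply: (@addIr _ (gdelta s' g)).
  by rewrite -gdeltaD !subrK.
pose gdelta_add : {additive R -> gring R G} :=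
  HB.pack (fun s : R => gdelta s g) (GRing.isZmodMorphism.Build _ _ _ gdelta_additive).
exact: esym (raddfMz gdelta_add m r).
Qed.

(** Each R_h moves the basis vector at 1 to the one at h, so R_w turns it into w itself; hence an
    operator R_w determines w. *)
Lemma rop_edelta1 (R : realType) (G : groupType) (w : gring R[i] G) g :
  rop w (edelta R 1%g) g = gcoef w g.
Proof.
rewrite [in RHS](gringE w) /= /rop_fun ell2_sumE gcoef_sum.
apply: eq_bigr => h _.
rewrite rtrans_delta mul1g ell2ZE gdeltaE /=.
by case: eqP; rewrite ?mulr1 ?mulr0.
Qed.

(** Both sides obey the same recursion on letters. Traversed backwards from g, the edge of x_j is
    based at g x_j^-1, which matches the Fox derivative -x_j^-1 of x_j^-1. *)
Lemma edge_path_fox n g (w : word 'I_n) j :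
  edge_path g w 0 j = zelt g * fox_word j w.
Proof.
elim: w g => [|[i b] w IH] g /=; first by rewrite mxE mulr0.
rewrite mxE IH zeltM mulrDr mulrA; congr (_ + _).
rewrite /edge /fox_letter /=; case: b => /=.
  by rewrite !mxE eqxx /= eq_sym; case: eqP.
rewrite !mxE eqxx /= eq_sym; case: eqP => [<-|_].
  by rewrite mulr1 mulrN zeltM.
by rewrite !mulr0 oppr0.
Qed.

(** Links the two representations: [burau2] is built from coordinates of lifted loops, [burau] from
    Fox derivatives. *)
Lemma path_lift_fox n (u : freegrp n) j : path_lift u 0 j = fox j (zelt u).
Proof. by rewrite edge_path_fox zelt1 mul1r -fox_class prepr. Qed.

Section Recovery.
Variables (R : realType) (n : nat) (G : groupType) (t : R).
Hypothesis t_gt0 : 0 < t.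
Variable gamma : {multiplicative freegrp n -> G}.

(** By additivity it suffices to take a multiple of one u. Its weight t^phi(u) depends only on the
    fibre of [psi] containing [gamma u], so it factors out. *)
Lemma fibre_sum_kappa (psi : G -> zmult) (w : gring int (freegrp n)) k :
  (forall u, phi u = psi (gamma u)) ->
  fibre_sum psi (kappa t gamma w) k =
  t ^ (k : int) * (gcoef (Tphi w) k)%:~R.
Proof.
move=> phiE; elim/gring_ind: w => [|v w IHv IHw|m u].
- by rewrite /kappa /Tphi !zext0 fibre_sum0 gcoef0 mulr0.
- rewrite /kappa /Tphi !zextD fibre_sumD gcoefD rmorphD mulrDr.
  by rewrite -[in RHS]/(Tphi v) -[in RHS]/(Tphi w) -IHv -IHw.
rewrite /kappa /Tphi !zextU /zelt !gdeltaMz fibre_sumU gdeltaE -phiE.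
rewrite eq_sym; case: eqP => [->|_]; last by rewrite mulr0.
by rewrite intz mulrzr.
Qed.

Lemma burau2_kappa alpha beta : burau2 t gamma alpha = burau2 t gamma beta ->
  forall i j, kappa t gamma (fox j (zelt (artin alpha (xgen i)))) =
              kappa t gamma (fox j (zelt (artin beta (xgen i)))).
Proof.
move=> eq2 i j; apply/gringP => g.
(* The indices are transposed: the image of x~_i is a column of [burau2] but a row of [burau]. *)
have burau2_coef c : burau2 t gamma c j i (edelta R 1%g) g =
    (gcoef (kappa t gamma (fox j (zelt (artin c (xgen i))))) g)%:C%C.
  rewrite burau2E braid_lift_xlift path_lift_fox -cgringE.
  exact: rop_edelta1.
apply: complexI; apply: etrans (burau2_coef beta).
by rewrite -eq2; apply: esym; apply: burau2_coef.
Qed.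

Lemma burau2_burau (psi : G -> zmult) alpha beta :
  (forall u, phi u = psi (gamma u)) ->
  burau2 t gamma alpha = burau2 t gamma beta -> burau alpha = burau beta.
Proof.
move=> phiE eq2; apply/matrixP => i j; rewrite !mxE; apply/gringP => k.
(* The integer coefficients are compared inside [R], where the factor t^k can be cancelled. *)
apply: (@intr_inj R); apply: (@mulfI _ (t ^ (k : int))).
  by rewrite expfz_neq0 // gt_eqF.
have := congr1 (fun w => fibre_sum psi w k) (burau2_kappa eq2 i j).
by rewrite (fibre_sum_kappa _ _ phiE) (fibre_sum_kappa _ _ phiE).
Qed.

End Recovery.

Theorem proposition4p5 (R : realType) (n : nat) (G : groupType)
    (G_countable : countable [set: G]) (t : R) (t_gt0 : 0 < t)
    (gamma : {multiplicative freegrp n -> G})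
    (phi_factors : exists psi : {multiplicative G -> zmult},
       forall u : freegrp n, phi u = psi (gamma u)) :
  (exists Theta : bop (@ell2n_norm R G n) -> 'M[laurent]_n,
     forall beta : braid n, Theta (mxop (burau2 t gamma beta)) = burau beta) /\
  (forall alpha beta : braid n,
     burau2 t gamma alpha = burau2 t gamma beta -> burau alpha = burau beta).
Proof.
have [psi phiE] := phi_factors.
have inj alpha beta :
    burau2 t gamma alpha = burau2 t gamma beta -> burau alpha = burau beta.
  exact: burau2_burau phiE.
split=> //.
have /choice[Theta ThetaE] : forall S : bop (@ell2n_norm R G n),
    exists B, forall beta : braid n,
      S = mxop (burau2 t gamma beta) -> B = burau beta.
  (* On the image of [burau2], injectivity of [mxop] makes the value independent of the chosen
     braid; elsewhere it is arbitrary, here 0. *)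
  move=> S; case: (pselect (exists alpha, S = mxop (burau2 t gamma alpha))).
    move=> [alpha ->]; exists (burau alpha) => beta /(can_inj (@mxopK R G n)).
    exact: inj.
  by move=> noS; exists 0 => beta Sbeta; case: noS; exists beta.
by exists Theta => beta; apply: ThetaE.
Qed.
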